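(* Let $\mathfrak{g}$ be a (possibly not nilpotent) Lie algebra endowed with a complex structure $J$, and let $n=\dim_{\mathbb{C}}\mathfrak{g}$. Then $(\mathfrak{g},J)$ is MaxN if and only if $\mathfrak{g}^{1,0}$ admits a basis $\{\omega^i\}_{i=1}^n$ satisfying $$d\omega^k=\sum_{i<j<k}A_{ij}^k\,\omega^i\wedge\omega^j+\sum_{i,j<k}B_{ij}^k\,\omega^i\wedge\overline{\omega}^j,\qquad 1\le k\le n,$$ where $A_{ij}^k,B_{ij}^k\in\mathbb{C}$ and, for each $2\le k\le n$, the coefficients $\{A_{i,k-1}^k\}_{i<k-1}$, $\{B_{k-1,j}^k\}_{j=1}^{k-1}$ and $\{B_{i,k-1}^k\}_{i<k-1}$ are not all zero. Moreover, if $(\mathfrak{g},J)$ is MaxN, then $$(\mathfrak{g}/\mathfrak{a}_{\nu(J)-k})^*_{\mathbb{C}}=W^k\oplus\overline{W}^k,\qquad 0\le k\le\nu(J).$$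
   Context: Lie algebras are real, of finite positive dimension. A complex structure on $\mathfrak{g}$ is a linear endomorphism $J:\mathfrak{g}\to\mathfrak{g}$ with $J^2=-1$ and $[JX,JY]=J[JX,Y]+J[X,JY]+[X,Y]$ for all $X,Y\in\mathfrak{g}$; $\dim_{\mathbb{C}}\mathfrak{g}=\frac12\dim_{\mathbb{R}}\mathfrak{g}$. $\mathfrak{g}^{1,0}$ is the $\sqrt{-1}$-eigenspace of $J$ acting on $\mathfrak{g}^*_{\mathbb{C}}=\mathfrak{g}^*\otimes_{\mathbb{R}}\mathbb{C}$ by $(J\alpha)(X)=\alpha(JX)$. $d$ is the Chevalley–Eilenberg differential, $d\alpha(X,Y)=-\alpha([X,Y])$, extended complex-linearly. Put $\mathfrak{a}_0=0$ and $\mathfrak{a}_k=\{X\in\mathfrak{g} : [X,\mathfrak{g}]\subseteq\mathfrak{a}_{k-1},\ [JX,\mathfrak{g}]\subseteq\mathfrak{a}_{k-1}\}$ for $k\ge1$; these are $J$-invariant ideals. $J$ is nilpotent if $\mathfrak{a}_t=\mathfrak{g}$ for some $t$, and then $\nu(J)$ is the smallest such $t$. Put $W^0=0$ and $W^k=\{\omega\in\mathfrak{g}^{1,0} : d\omega\in (W^{k-1}\wedge W^{k-1})\oplus(W^{k-1}\wedge\overline{W}^{k-1})\}$ for $k\ge1$. $(\mathfrak{g},J)$ is MaxN (maximal nilpotent) if $\mathfrak{g}$ is a nilpotent Lie algebra and $J$ is a nilpotent complex structure on it with $\nu(J)=\dim_{\mathbb{C}}\mathfrak{g}$. The complexified dual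 $(\mathfrak{g}/\mathfrak{a}_m)^*_{\mathbb{C}}=(\mathfrak{g}/\mathfrak{a}_m)^*\otimes_{\mathbb{R}}\mathbb{C}$ is regarded as a subspace of $\mathfrak{g}^*_{\mathbb{C}}$ via the projection $\mathfrak{g}\to\mathfrak{g}/\mathfrak{a}_m$. *)

(* Defs.v *)
From HB Require Import structures.
From mathcomp Require Import all_boot all_order all_algebra.
From mathcomp Require Import sesquilinear complex.
From mathcomp Require Import boolp reals.
From mathcomp Require Import ring.

Set Implicit Arguments.
Unset Strict Implicit.
Unset Printing Implicit Defensive.

Import GRing.Theory.
Local Open Scope ring_scope.

HB.mixin Record Vector_isLieAlgebra (K : fieldType) g of Vector K g := {
  lie : g -> g -> g;
  lie_bilinear : bilinear_for *:%R *:%R lie;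
  liexx : forall x, lie x x = 0;
  lie_jacobi : forall x y z,
    lie x (lie y z) + lie y (lie z x) + lie z (lie x y) = 0
}.

#[short(type="lieAlgType")]
HB.structure Definition LieAlgebra (K : fieldType) :=
  { g of Vector_isLieAlgebra K g & Vector K g }.

HB.instance Definition _ (K : fieldType) (g : lieAlgType K) :=
  bilinear_isBilinear.Build K g g g *:%R *:%R (@lie K g) lie_bilinear.
HB.instance Definition _ (K : fieldType) (g : lieAlgType K) (X : g) :=
  GRing.isLinear.Build K g g *:%R (lie X) (lie_bilinear.2 X).

Section BilinearSpan.
Variables (K : fieldType) (U V W : vectType K).

(* The span of all f a b with a in A and b in B when f is bilinear, see
   bilspan_subP. *)
Definition bilspan (f : U -> V -> W) (A : {vspace U}) (B : {vspace V}) :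
  {vspace W} := <<[seq f a b | a <- vbasis A, b <- vbasis B]>>%VS.

Lemma bilspan_subP (f : {bilinear U -> V -> W}) (A : {vspace U})
    (B : {vspace V}) (S : {vspace W}) :
  (forall a b, a \in A -> b \in B -> f a b \in S) <-> (bilspan f A B <= S)%VS.
Proof.
split=> [fS|/span_subvP fS a b aA bB].
  apply/span_subvP=> _ /allpairsP[[a b] /= [aA bB ->]].
  by apply: fS; rewrite vbasis_mem.
rewrite (coord_vbasis aA) linear_sumlz memv_suml // => i _.
rewrite linearZl_LR /= memvZ // (coord_vbasis bB) linear_sumr.
rewrite memv_suml // => j _; rewrite linearZr_LR /= memvZ // fS //.
by apply/allpairsP; exists ((vbasis A)`_i, (vbasis B)`_j);
  rewrite /= !mem_nth ?size_tuple.
Qed.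
End BilinearSpan.

Section Pullback.
Variables (K : fieldType) (U V W : vectType K) (f : 'Hom(U, V)).

Definition pullback_fun (a : 'Hom(V, W)) : 'Hom(U, W) := (a \o f)%VF.

Fact pullback_fun_is_linear : linear pullback_fun.
Proof.
move=> c a b; apply/lfunP=> x.
by rewrite !(comp_lfunE, add_lfunE, scale_lfunE).
Qed.
HB.instance Definition _ := GRing.isLinear.Build K 'Hom(V, W) 'Hom(U, W) _
  pullback_fun pullback_fun_is_linear.

Definition pullback : 'Hom('Hom(V, W), 'Hom(U, W)) := linfun pullback_fun.

Lemma pullbackE a x : pullback a x = a (f x).
Proof. by rewrite lfunE /= comp_lfunE. Qed.
End Pullback.

Section Quotient.
Variables (K : fieldType) (V : vectType K) (A : {vspace V}).

(* V / A, modelled on the complement A^C; quotv_proj is the projection with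
   kernel A, see quotv_proj_surj and lker_quotv_proj. *)
Definition quotv := subvs_of (A^C)%VS.

Definition quotv_proj : 'Hom(V, quotv) :=
  (linfun (vsproj A^C) \o daddv_pi A^C A)%VF.

Let capCA : (A^C :&: A = 0)%VS.
Proof. by rewrite capvC capv_compl. Qed.

Lemma quotv_projE v : vsval (quotv_proj v) = daddv_pi A^C A v.
Proof. by rewrite comp_lfunE lfunE /= vsprojK // memv_pi. Qed.

Lemma quotv_proj_surj (q : quotv) : quotv_proj (vsval q) = q.
Proof. by apply: subvs_inj; rewrite quotv_projE daddv_pi_id // subvsP. Qed.

Lemma lker_quotv_proj : lker quotv_proj = A.
Proof.
apply/vspaceP=> v; rewrite memv_ker.
have -> : (quotv_proj v == 0) = (daddv_pi A^C A v == 0).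
  by rewrite -quotv_projE; apply/eqP/eqP => [->|q0];
    [exact: linear0|exact: subvs_inj].
have vCA : v \in (A^C + A)%VS by rewrite addvC addv_complf memvf.
have := daddv_pi_add capCA vCA.
have [-> |nz] := eqVneq.
  by rewrite add0r => <-; rewrite memv_pi.
move=> _; apply/esym/negbTE; apply: contra nz => vA.
have := daddv_pi_add capCA vCA.
rewrite (@daddv_pi_id _ _ A A^C) ?capv_compl // -[X in _ = X]add0r.
by move/addIr/eqP.
Qed.
End Quotient.

(* V (x)_R C, with (u, v) standing for u (x) 1 + v (x) i. *)
Definition complexification (R : rcfType) (V : vectType R) : Type :=
  (V * V)%type.

Section Complexification.
Variables (R : rcfType) (V : vectType R).

HB.instance Definition _ :=
  GRing.Zmodule.copy (complexification V) (V * V)%type.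

Definition cscale (z : R[i]) (w : complexification V) : complexification V :=
  (complex.Re z *: w.1 - complex.Im z *: w.2,
   complex.Re z *: w.2 + complex.Im z *: w.1).

Fact cscaleA z z' w : cscale z (cscale z' w) = cscale (z * z') w.
Proof.
case: z z' w => [a b] [a' b'] [u v]; congr pair => /=.
  rewrite !scalerDr !scalerN !scalerA !scalerBl !scalerDl !opprD.
  by rewrite -!addrA; congr (_ + _); rewrite addrA addrC.
rewrite !scalerDr !scalerN !scalerA !scalerBl !scalerDl.
by rewrite -!addrA; congr (_ + _); rewrite addrA addrC.
Qed.

Fact cscale1 : left_id 1 cscale.
Proof. by case=> u v; rewrite /cscale /= !scale1r !scale0r subr0 addr0. Qed.

Fact cscaleDr : right_distributive cscale +%R.
Proof.
case=> [a b] [u v] [u' v']; congr pair => /=; rewrite !scalerDr.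
  by rewrite opprD addrACA.
by rewrite addrACA.
Qed.

Fact cscaleDl w : {morph cscale^~ w : z z' / z + z'}.
Proof.
case: w => u v [a b] [a' b']; congr pair => /=; rewrite !scalerDl.
  by rewrite opprD addrACA.
by rewrite addrACA.
Qed.

HB.instance Definition _ := GRing.Zmodule_isLmodule.Build R[i]
  (complexification V) cscaleA cscale1 cscaleDr cscaleDl.

Fact complexification_vect_axiom : Vector.axiom (dim V) (complexification V).
Proof.
pose e := @VectorInternalTheory.v2r R V.
have [eZ eD] : semilinear e :=
  v2r_semilinear (VectorInternalTheory.v2r_subproof V).
have eN x : e (- x) = - e x by rewrite -scaleN1r eZ scaleN1r.
pose e' := @VectorInternalTheory.r2v R V.
pose h (w : complexification V) : 'rV[R[i]]_(dim V) :=
  \row_j Complex (e w.1 ord0 j) (e w.2 ord0 j).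
pose h' (r : 'rV[R[i]]_(dim V)) : complexification V :=
  (e' (map_mx (@complex.Re R) r), e' (map_mx (@complex.Im R) r)).
exists h.
  move=> [a b] [u v] [u' v']; apply/rowP=> j; rewrite !mxE /=.
  by rewrite !(eD, eN, eZ) !mxE; congr Complex.
exists h'.
  case=> u v; rewrite /h' /h; congr pair;
  rewrite -[RHS]VectorInternalTheory.v2rK; congr (e' _);
  by apply/rowP=> j; rewrite !mxE.
move=> r; apply/rowP=> j; rewrite /h /h' !mxE /= /e /e'.
by rewrite !VectorInternalTheory.r2vK !mxE; case: (r 0 j).
Qed.

HB.instance Definition _ := Lmodule_hasFinDim.Build R[i] (complexification V)
  complexification_vect_axiom.

Definition conjv (w : complexification V) : complexification V :=
  (w.1, - w.2).

Lemma conjvK : involutive conjv.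
Proof. by case=> u v; rewrite /conjv /= opprK. Qed.

Lemma conjvD u v : conjv (u + v) = conjv u + conjv v.
Proof. by congr pair; rewrite /= opprD. Qed.

Lemma conjvZ z v : conjv (z *: v) = conjc z *: conjv v.
Proof.
case: z v => a b [u v]; congr pair => /=.
  by rewrite scalerN scaleNr opprK.
by rewrite opprD scalerN scaleNr.
Qed.

Lemma conjv0 : conjv 0 = 0.
Proof. by congr pair; rewrite /= oppr0. Qed.

(* The complex subspace {conjv a | a \in A}, see mem_conj_vspace. *)
Definition conj_vspace (A : {vspace complexification V}) :
  {vspace complexification V} := <<[seq conjv a | a <- vbasis A]>>%VS.

Lemma mem_conj_vspace (A : {vspace complexification V}) w :
  (w \in conj_vspace A) = (conjv w \in A).
Proof.
have conj_sum n (F : 'I_n -> complexification V) :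
    conjv (\sum_i F i) = \sum_i conjv (F i).
  by apply: (big_morph conjv conjvD conjv0).
apply/idP/idP => [wA|wA].
  rewrite (coord_span wA) conj_sum memv_suml // => i _.
  rewrite conjvZ memvZ // (nth_map 0) ?conjvK ?size_tuple //.
  by rewrite vbasis_mem // mem_nth // size_tuple.
rewrite -[w]conjvK (coord_vbasis wA) conj_sum memv_suml // => i _.
rewrite conjvZ memvZ // memv_span //; apply: map_f.
by rewrite mem_nth // size_tuple.
Qed.
End Complexification.

Section ComplexifiedMap.
Variables (R : rcfType) (U V : vectType R) (f : 'Hom(U, V)).

Definition complexify_fun (w : complexification U) : complexification V :=
  (f w.1, f w.2).

Fact complexify_fun_is_linear : linear complexify_fun.
Proof.
move=> [a b] [u v] [u' v'].
by congr pair; rewrite /= !linearD ?linearN /= !linearZ.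
Qed.
HB.instance Definition _ := GRing.isLinear.Build R[i]
  (complexification U) (complexification V) _ complexify_fun
  complexify_fun_is_linear.

Definition complexify : 'Hom(complexification U, complexification V) :=
  linfun complexify_fun.

Lemma complexifyE w : complexify w = (f w.1, f w.2).
Proof. by rewrite lfunE. Qed.
End ComplexifiedMap.

Section Forms.
Variables (R : rcfType) (V : vectType R).

Definition cdual := complexification 'Hom(V, R^o).

(* Complex-valued R-bilinear forms on V. *)
Definition cbilform := complexification 'Hom(V, 'Hom(V, R^o)).

HB.instance Definition _ := Vector.on cdual.
HB.instance Definition _ := Vector.on cbilform.

Definition cdual_eval (a : cdual) (X : V) : R[i] := Complex (a.1 X) (a.2 X).
Definition cbilform_eval (b : cbilform) (X Y : V) : R[i] :=
  Complex (b.1 X Y) (b.2 X Y).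

Lemma cdual_evalD a b X :
  cdual_eval (a + b) X = cdual_eval a X + cdual_eval b X.
Proof. by rewrite /cdual_eval /= !add_lfunE. Qed.

Lemma cdual_evalZ z a X : cdual_eval (z *: a) X = z * cdual_eval a X.
Proof.
by case: z => x y; rewrite /cdual_eval /= !(add_lfunE, opp_lfunE, scale_lfunE).
Qed.

Lemma cbilform_evalD a b X Y :
  cbilform_eval (a + b) X Y = cbilform_eval a X Y + cbilform_eval b X Y.
Proof. by rewrite /cbilform_eval /= !add_lfunE. Qed.

Lemma cbilform_evalZ z a X Y :
  cbilform_eval (z *: a) X Y = z * cbilform_eval a X Y.
Proof.
by case: z => x y;
  rewrite /cbilform_eval /= !(add_lfunE, opp_lfunE, scale_lfunE).
Qed.

Lemma cbilform_inj (u v : cbilform) :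
  (forall X Y, cbilform_eval u X Y = cbilform_eval v X Y) -> u = v.
Proof.
by case: u v => [u u'] [v v'] uv; congr pair; apply/lfunP=> X; apply/lfunP=> Y;
  case: (uv X Y).
Qed.

Lemma cdual_inj (u v : cdual) :
  (forall X, cdual_eval u X = cdual_eval v X) -> u = v.
Proof.
by case: u v => [u u'] [v v'] uv; congr pair; apply/lfunP=> X; case: (uv X).
Qed.

Section RealWedge.
Variables a b : 'Hom(V, R^o).

Definition real_wedge_fun (X : V) : 'Hom(V, R^o) := a X *: b - b X *: a.

Fact real_wedge_fun_is_linear : linear real_wedge_fun.
Proof.
move=> c X Y; apply/lfunP=> Z.
rewrite !(add_lfunE, opp_lfunE, scale_lfunE) !linearP /=.
by rewrite /GRing.scale /=; ring.
Qed.
HB.instance Definition _ := GRing.isLinear.Build R V 'Hom(V, R^o) _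
  real_wedge_fun real_wedge_fun_is_linear.

Definition real_wedge : 'Hom(V, 'Hom(V, R^o)) := linfun real_wedge_fun.

Lemma real_wedgeE X Y : real_wedge X Y = a X * b Y - b X * a Y.
Proof. by rewrite lfunE /= !(add_lfunE, opp_lfunE, scale_lfunE). Qed.
End RealWedge.

(* The complex bilinear extension of real_wedge. *)
Definition wedge (a b : cdual) : cbilform :=
  (real_wedge a.1 b.1 - real_wedge a.2 b.2,
   real_wedge a.1 b.2 + real_wedge a.2 b.1).

Lemma wedgeE a b X Y :
  cbilform_eval (wedge a b) X Y =
  cdual_eval a X * cdual_eval b Y - cdual_eval a Y * cdual_eval b X.
Proof.
rewrite /cbilform_eval /wedge /= !(add_lfunE, opp_lfunE) !real_wedgeE.
apply/eqP; rewrite eq_complex /=; apply/andP; split; apply/eqP.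
  by ring.
by ring.
Qed.

Fact wedge_is_bilinear : bilinear_for *:%R *:%R wedge.
Proof.
split=> c z a b; apply: cbilform_inj => X Y;
  rewrite !(cbilform_evalD, cbilform_evalZ, wedgeE, cdual_evalD, cdual_evalZ);
  by ring.
Qed.
HB.instance Definition _ := bilinear_isBilinear.Build R[i] cdual cdual cbilform
  *:%R *:%R wedge wedge_is_bilinear.
End Forms.

Section LieAlgebra.
Variables (K : fieldType) (g : lieAlgType K).

Definition ad (X : g) : 'End(g) := linfun (lie X).

Lemma adE X Y : ad X Y = lie X Y. Proof. by rewrite /ad lfunE. Qed.

Lemma lieC (X Y : g) : lie X Y = - lie Y X.
Proof.
apply/eqP; rewrite -addr_eq0; have := liexx (X + Y).
by rewrite linearDl !linearDr /= !liexx add0r addr0 => ->.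
Qed.

(* The subspace {X | [X, g] \subset A}, see lie_intoP. *)
Definition lie_into (A : {vspace g}) : {vspace g} :=
  (\bigcap_(i < \dim {:g}) (ad (vbasis {:g})`_i @^-1: A))%VS.

Lemma lie_intoP (A : {vspace g}) X :
  (forall Y, lie X Y \in A) <-> X \in lie_into A.
Proof.
have lieCA Y : (lie X Y \in A) = (X \in (ad Y @^-1: A)%VS).
  by rewrite -memv_preim adE lieC memvN.
rewrite memvE; split=> [XA|/subv_bigcapP XA Y].
  by apply/subv_bigcapP=> i _; rewrite -memvE -lieCA.
rewrite (coord_vbasis (memvf Y)) linear_sumr memv_suml // => i _.
by rewrite linearZr_LR /= memvZ // lieCA memvE XA.
Qed.

(* The lower central series. *)
Fixpoint lower_central (k : nat) : {vspace g} :=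
  if k is k'.+1 then bilspan lie {:g} (lower_central k') else {:g}%VS.

Definition nilpotent_lie : Prop := exists k, lower_central k = 0%VS.
End LieAlgebra.

Section Differential.
Variables (R : rcfType) (g : lieAlgType R).

Definition real_d_fun2 (a : 'Hom(g, R^o)) (X : g) : 'Hom(g, R^o) :=
  - (a \o ad X)%VF.

Fact real_d_fun2_is_linear a : linear (real_d_fun2 a).
Proof.
move=> c X Y; apply/lfunP=> Z.
rewrite !(add_lfunE, opp_lfunE, scale_lfunE, comp_lfunE) !adE.
by rewrite linearPl [a _]linearP /= opprD scalerN.
Qed.
HB.instance Definition _ a := GRing.isLinear.Build R g 'Hom(g, R^o) _
  (real_d_fun2 a) (real_d_fun2_is_linear a).

Definition real_d_fun (a : 'Hom(g, R^o)) : 'Hom(g, 'Hom(g, R^o)) :=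
  linfun (real_d_fun2 a).

Lemma real_d_funE a X Y : real_d_fun a X Y = - a (lie X Y).
Proof.
by rewrite /real_d_fun lfunE /= /real_d_fun2 opp_lfunE comp_lfunE adE.
Qed.

Fact real_d_fun_is_linear : linear real_d_fun.
Proof.
move=> c a b; apply/lfunP=> X; apply/lfunP=> Y.
rewrite !(add_lfunE, scale_lfunE) !real_d_funE add_lfunE scale_lfunE.
by rewrite opprD scalerN.
Qed.
HB.instance Definition _ := GRing.isLinear.Build R
  'Hom(g, R^o) 'Hom(g, 'Hom(g, R^o)) _ real_d_fun real_d_fun_is_linear.

(* The Chevalley-Eilenberg differential on 1-forms. *)
Definition ce_d : 'Hom(cdual g, cbilform g) := complexify (linfun real_d_fun).

Lemma ce_dE a X Y :
  cbilform_eval (ce_d a) X Y = - cdual_eval a (lie X Y).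
Proof.
have dE b : linfun real_d_fun b = real_d_fun b by rewrite lfunE.
by rewrite /cbilform_eval complexifyE /= !dE !real_d_funE.
Qed.
End Differential.

Definition dimC (R : rcfType) (V : vectType R) : nat := (\dim {:V})./2.

(* (V / A)^* (x) C inside V^* (x) C, by pulling back along V -> V / A. *)
Definition quot_cdual (R : rcfType) (V : vectType R) (A : {vspace V}) :
  {vspace cdual V} := limg (complexify (pullback R^o (quotv_proj A))).

Lemma quot_cdualP (R : rcfType) (V : vectType R) (A : {vspace V})
    (a : cdual V) :
  (forall X, X \in A -> cdual_eval a X = 0) <-> a \in quot_cdual A.
Proof.
split=> [aA|/memv_imgP[b _ ->] X XA]; last first.
  have : X \in lker (quotv_proj A) by rewrite lker_quotv_proj.
  rewrite memv_ker => /eqP X0.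
  by rewrite /cdual_eval complexifyE /= !pullbackE X0 !linear0.
have aE X : cdual_eval a (vsval (quotv_proj A X)) = cdual_eval a X.
  suff : cdual_eval a (X - vsval (quotv_proj A X)) = 0.
    by rewrite /cdual_eval !linearB => -[/subr0_eq <- /subr0_eq <-].
  apply: aA; have : X - vsval (quotv_proj A X) \in lker (quotv_proj A).
    by rewrite memv_ker linearB /= quotv_proj_surj subrr.
  by rewrite lker_quotv_proj.
pose s : 'Hom(quotv A, V) := linfun vsval.
have sE q : s q = vsval q by rewrite lfunE.
have -> : a = complexify (pullback R^o (quotv_proj A))
                (complexify (pullback R^o s) a).
  apply: cdual_inj => X; rewrite -aE !complexifyE /cdual_eval /=.
  by rewrite !pullbackE !sE.
by rewrite memv_img ?memvf.
Qed.

Section ComplexStructure.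
Variables (R : rcfType) (g : lieAlgType R) (J : 'End(g)).

Definition complex_structure : Prop :=
  (forall X, J (J X) = - X) /\
  (forall X Y, lie (J X) (J Y) =
     J (lie (J X) Y) + J (lie X (J Y)) + lie X Y).

Definition forms10 : {vspace cdual g} :=
  passmx.leigenspace (complexify (pullback R^o J)) 'i%C.

Lemma forms10P (a : cdual g) :
  (forall X, cdual_eval a (J X) = 'i%C * cdual_eval a X) <-> a \in forms10.
Proof.
rewrite memv_ker add_lfunE opp_lfunE scale_lfunE id_lfunE subr_eq0.
split=> [aJ|/eqP aJ X].
  apply/eqP/cdual_inj=> X; rewrite complexifyE cdual_evalZ -aJ.
  by rewrite /cdual_eval /= !pullbackE.
by rewrite -cdual_evalZ -aJ complexifyE /cdual_eval /= !pullbackE.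
Qed.

(* a_{k+1} = {X | [X, g] and [JX, g] lie in a_k}, see ascSP. *)
Fixpoint asc (k : nat) : {vspace g} :=
  if k is k'.+1 then (lie_into (asc k') :&: J @^-1: lie_into (asc k'))%VS
  else 0%VS.

Lemma ascSP k X :
  (forall Y, lie X Y \in asc k /\ lie (J X) Y \in asc k) <-> X \in asc k.+1.
Proof.
rewrite /= memv_cap -memv_preim; split=> [H|].
  by apply/andP; split; apply/lie_intoP=> Y; case: (H Y).
by case/andP=> /lie_intoP H1 /lie_intoP H2 Y.
Qed.

Definition nilpotent_complex_structure : Prop := exists t, asc t == {:g}%VS.

(* The least t with asc t = g; 0 if J is not nilpotent. *)
Definition nu : nat :=
  if pselect nilpotent_complex_structure is left ex_t then ex_minn ex_t
  else 0%N.

Definition MaxN : Prop :=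
  [/\ nilpotent_lie g, nilpotent_complex_structure & nu = dimC g].

(* The sum of the two spans is direct: for W inside forms10, they consist of
   forms of types (2,0) and (1,1). *)
Fixpoint Wseries (k : nat) : {vspace cdual g} :=
  if k is k'.+1 then
    (forms10 :&: ce_d g @^-1:
       (bilspan (@wedge R g) (Wseries k') (Wseries k') +
        bilspan (@wedge R g) (Wseries k') (conj_vspace (Wseries k'))))%VS
  else 0%VS.

End ComplexStructure.

(* Main.v *)
Require Import Defs.
From mathcomp Require Import all_boot all_order all_algebra.
From mathcomp Require Import sesquilinear complex boolp reals ring.

Set Implicit Arguments.
Unset Strict Implicit.
Unset Printing Implicit Defensive.

Import GRing.Theory.
Local Open Scope ring_scope.

(** Write [n] for the complex dimension, [a_m] for [asc J m], and [U_k] for the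
    space of (1,0)-forms that vanish on [a_(n-k)] ([flag J k]). Everything
    follows from comparing the ideals [a_m] with their annihilators.

    A [J]-stable subspace [A] is the common kernel of the (1,0)-forms that
    vanish on it ([ann10_separates]), and the forms vanishing on [A] are the sum
    of these (1,0)-forms and of their conjugates ([quot_cdual_split]). If [a] is
    a (1,0)-form with [a([A, g]) = 0], then [d a] is built from forms vanishing
    on [A] alone, and integrability of [J] removes its (0,2) part
    ([ce_d_mem_wedge_span]). As [a_(m+1)] consists of the [X] such that [X] and
    [J X] bracket [g] into [a_m], it follows that [d U_(k+1)] lies in the wedge
    products of [U_k] with itself and with its conjugate.

    If [J] is maximal nilpotent, the [n] inclusions [a_m < a_(m+1)] are strict,
    hence so are the [n] inclusions [U_k < U_(k+1)]. The (1,0)-forms have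
    dimension at most [n], so [U_k] has dimension [k], and picking one form in
    each [U_(k+1)] outside [U_k] gives a basis with the structure equations.
    The coefficients at the last index cannot all vanish: otherwise
    [d U_(p+2)] would vanish on [a_(n-p)], so that bracketing with [a_(n-p)]
    would end in [a_(n-p-2)], which forces [a_(n-p)] into [a_(n-p-1)]
    ([flag_d_nondegenerate]). The same argument shows that a form whose
    differential lives on [U_k] belongs to [U_(k+1)], so that [W^k = U_k]
    ([Wseries_flag]); the last assertion is then the splitting above.

    Conversely, given a basis [w] with the structure equations, [a_m] is shown
    by induction on [m] to be the common kernel of the first [n - m] forms
    ([structure_asc]). The step is the following: if [X] is killed by the forms
    before [w_l], and [X] and [J X] contract [d w_(l+1)] to zero, then
    [w_l(X) = 0], because the coefficients of the contractions are those
    assumed to be not all zero, times [w_l(X)] or its conjugate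
    ([top_index_vanish]). So [a_n = g], and [a_m <> g] for [m < n]. *)

(** * Evaluation of forms *)

Local Notation ev := cdual_eval.
Local Notation bev := cbilform_eval.

Lemma mulii (R : rcfType) : 'i%C * 'i%C = -1 :> R[i].
Proof. by rewrite -expr2 sqr_i. Qed.

Lemma conjc_iM (R : rcfType) (z : R[i]) : conjc ('i%C * z) = - 'i%C * conjc z.
Proof.
case: z => x y; apply/eqP; rewrite eq_complex /=.
by apply/andP; split; apply/eqP; ring.
Qed.

Section Evaluation.
Variables (R : rcfType) (V : vectType R).
Implicit Types (a b : cdual V) (X Y : V).

Lemma cdual_eval0 X : ev (0 : cdual V) X = 0.
Proof. by rewrite -(scale0r (0 : cdual V)) cdual_evalZ mul0r. Qed.

Lemma cdual_eval_sum (I : finType) (P : pred I) (F : I -> cdual V) X :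
  ev (\sum_(i | P i) F i) X = \sum_(i | P i) ev (F i) X.
Proof.
apply: (big_morph (fun a => ev a X)) => [a b|]; first exact: cdual_evalD.
exact: cdual_eval0.
Qed.

Lemma cbilform_eval0 X Y : bev (0 : cbilform V) X Y = 0.
Proof. by rewrite -(scale0r (0 : cbilform V)) cbilform_evalZ mul0r. Qed.

Lemma cbilform_evalN (b : cbilform V) X Y : bev (- b) X Y = - bev b X Y.
Proof.
by apply/eqP; rewrite -addr_eq0 -cbilform_evalD addNr cbilform_eval0.
Qed.

Lemma wedgeC a b : wedge a b = - wedge b a.
Proof.
apply: cbilform_inj => X Y; rewrite cbilform_evalN !wedgeE.
by rewrite opprB mulrC [ev a Y * _]mulrC.
Qed.

Lemma cbilform_eval_sum (I : finType) (P : pred I) (F : I -> cbilform V) X Y :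
  bev (\sum_(i | P i) F i) X Y = \sum_(i | P i) bev (F i) X Y.
Proof.
apply: (big_morph (fun b : cbilform V => bev b X Y)) => [a b|].
  exact: cbilform_evalD.
exact: cbilform_eval0.
Qed.

Lemma cdual_eval_conj a X : ev (conjv a) X = conjc (ev a X).
Proof. by rewrite /cdual_eval /= opp_lfunE. Qed.

Lemma cdual_evalN a X : ev (- a) X = - ev a X.
Proof. by rewrite -scaleN1r cdual_evalZ mulN1r. Qed.

Lemma cdual_evalNr a X : ev a (- X) = - ev a X.
Proof. by rewrite /cdual_eval !linearN. Qed.

Lemma cdual_evalDr a X Y : ev a (X + Y) = ev a X + ev a Y.
Proof. by rewrite /cdual_eval !linearD. Qed.

Lemma conjv_sum (I : finType) (P : pred I) (F : I -> cdual V) :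
  conjv (\sum_(i | P i) F i) = \sum_(i | P i) conjv (F i).
Proof. exact: (big_morph (@conjv _ _) (@conjvD _ _) (@conjv0 _ _)). Qed.

(** The real-linear form that agrees with [f] on the chosen basis of [V]; it is
    [f] itself whenever [f] is real-linear. *)
Definition form_of (f : V -> R[i]) : cdual V :=
  (\sum_(i < \dim {:V}) complex.Re (f (vbasis {:V})`_i) *: 
     (linfun (coord (vbasis {:V}) i : V -> R^o)),
   \sum_(i < \dim {:V}) complex.Im (f (vbasis {:V})`_i) *: 
     (linfun (coord (vbasis {:V}) i : V -> R^o))).

Lemma form_ofE (f : V -> R[i]) :
  (forall c X Y, f (c *: X + Y) = c%:C%C * f X + f Y) ->
  forall X, ev (form_of f) X = f X.
Proof.
move=> f_lin X.
have f0 : f 0 = 0.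
  by have := f_lin (-1) 0 0; rewrite scaler0 addr0 rmorphN mulN1r addNr.
have fsum (I : finType) (c : I -> R) (v : I -> V) :
    f (\sum_i c i *: v i) = \sum_i (c i)%:C%C * f (v i).
  by elim/big_rec2: _ => // i z Z _ <-; rewrite f_lin.
rewrite [in RHS](coord_vbasis (memvf X)) fsum /cdual_eval /=.
have Re_sum (F : 'I_(\dim {:V}) -> R[i]) :
    complex.Re (\sum_i F i) = \sum_i complex.Re (F i).
  by apply: (big_morph (@complex.Re R)) => // -[? ?] [? ?].
have Im_sum (F : 'I_(\dim {:V}) -> R[i]) :
    complex.Im (\sum_i F i) = \sum_i complex.Im (F i).
  by apply: (big_morph (@complex.Im R)) => // -[? ?] [? ?].
rewrite !sum_lfunE; apply/eqP; rewrite eq_complex /= Re_sum Im_sum.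
by apply/andP; split; apply/eqP/eq_bigr => i _;
  rewrite scale_lfunE lfunE; case: (f _) => x y /=;
  rewrite mul0r ?subr0 ?addr0 mulrC.
Qed.
End Evaluation.

(** * Spans of wedge products *)

Section BilinearSpan.
Variables (K : fieldType) (U V W : vectType K).

Lemma memv_bilspan (f : {bilinear U -> V -> W}) (A : {vspace U})
    (B : {vspace V}) a b :
  a \in A -> b \in B -> f a b \in bilspan f A B.
Proof. by move=> aA bB; apply: (iffRL (bilspan_subP f A B _)). Qed.

Lemma bilspan_ind (P : W -> Prop) (f : {bilinear U -> V -> W})
    (A : {vspace U}) (B : {vspace V}) :
  P 0 -> (forall c x y, P x -> P y -> P (c *: x + y)) ->
  (forall a b, a \in A -> b \in B -> P (f a b)) ->
  forall x, x \in bilspan f A B -> P x.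
Proof.
move=> P0 Plin Pf x; set s := [seq f a b | a <- vbasis A, b <- vbasis B].
move=> xs; have {xs} /coord_span-> : x \in <<in_tuple s>>%VS by [].
have PD c y (i : 'I_(size s)) : P y -> P (c *: s`_i + y).
  move=> Py; apply: Plin => //.
  have /allpairsP[[a b] /= [aA bB ->]] := mem_nth 0 (ltn_ord i).
  by apply: Pf; apply: vbasis_mem.
by elim/big_rec: _ => // i y _; apply: PD.
Qed.
End BilinearSpan.

(** The same facts for [wedge] as a bare function, so that using them involves
    no search for its bilinear structure. *)
Section WedgeSpan.
Variables (R : rcfType) (V : vectType R).
Implicit Types (A B : {vspace cdual V}).

Let wedge_bil : {bilinear cdual V -> cdual V -> cbilform V} := @wedge R V.

Lemma bilspan_wedge_ind (P : cbilform V -> Prop) A B :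
  P 0 -> (forall c x y, P x -> P y -> P (c *: x + y)) ->
  (forall a b, a \in A -> b \in B -> P (wedge a b)) ->
  forall x, x \in bilspan (@wedge R V) A B -> P x.
Proof. exact: (@bilspan_ind _ _ _ _ P wedge_bil). Qed.

Lemma bilspan_wedge_sub A B (S : {vspace cbilform V}) :
  (forall a b, a \in A -> b \in B -> wedge a b \in S) ->
  (bilspan (@wedge R V) A B <= S)%VS.
Proof. exact: (iffLR (bilspan_subP wedge_bil A B S)). Qed.

Lemma memv_bilspan_wedge A B a b :
  a \in A -> b \in B -> wedge a b \in bilspan (@wedge R V) A B.
Proof. exact: (memv_bilspan wedge_bil). Qed.
End WedgeSpan.

Section AlternatingForms.
Variables (R : rcfType) (V : vectType R).

(** The two-forms allowed for the differentials of the next term in the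
    recursion that defines [Wseries]. *)
Definition wedge_span (U : {vspace cdual V}) : {vspace cbilform V} :=
  (bilspan (@wedge R V) U U + bilspan (@wedge R V) U (conj_vspace U))%VS.

(** Each contraction [b X] vanishes on [A], so it expands in a basis [e_i] of
    the forms vanishing on [A]. The coefficients, as functions of [X], are forms
    [c_i] that vanish on [A] too, and antisymmetrizing the expansion turns it
    into half the sum of the [c_i] wedge [e_i]. *)
Lemma alternating_mem_bilspan (A : {vspace V}) (b : cbilform V) :
  (forall X Y, bev b X Y = - bev b Y X) ->
  (forall X Y, X \in A -> bev b X Y = 0) ->
  b \in bilspan (@wedge R V) (quot_cdual A) (quot_cdual A).
Proof.
move=> balt bA; set Q := quot_cdual A; pose e := vbasis Q.
pose ins X : cdual V := (b.1 X, b.2 X).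
have insE X Y : ev (ins X) Y = bev b X Y by [].
have insQ X : ins X \in Q.
  by apply/quot_cdualP => Y YA; rewrite insE balt bA ?oppr0.
have ins_lin k X Y : ins (k *: X + Y) = k%:C%C *: ins X + ins Y.
  apply: cdual_inj => Z; rewrite cdual_evalD cdual_evalZ !insE.
  rewrite /cbilform_eval !linearP /= !add_lfunE !scale_lfunE.
  by apply/eqP; rewrite eq_complex /= !mul0r subr0 addr0 !eqxx.
pose c i := form_of (fun X => coord e i (ins X)).
have cE i X : ev (c i) X = coord e i (ins X).
  by rewrite form_ofE // => k Y Z; rewrite ins_lin linearP.
have cQ i : c i \in Q.
  apply/quot_cdualP => X XA; rewrite cE (_ : ins X = 0) ?linear0 //.
  by apply: cdual_inj => Y; rewrite insE bA // cdual_eval0.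
have bE X Y : bev b X Y = \sum_i ev (c i) X * ev e`_i Y.
  rewrite -insE [in LHS](coord_vbasis (insQ X)) cdual_eval_sum.
  by apply: eq_bigr => i _; rewrite cdual_evalZ cE.
suff -> : b = 2^-1 *: \sum_i wedge (c i) e`_i.
  rewrite memvZ // memv_suml // => i _; apply: memv_bilspan_wedge => //.
  by rewrite vbasis_mem // mem_nth // size_tuple.
apply: cbilform_inj => X Y; rewrite cbilform_evalZ cbilform_eval_sum.
under eq_bigr do rewrite wedgeE.
rewrite sumrB -!bE [bev b Y X]balt opprK -mulr2n -[X in _ * X]mulr_natl.
by rewrite mulKf // Num.Theory.pnatr_eq0.
Qed.
End AlternatingForms.

(** * Types of forms *)

Section Types.
Variables (R : rcfType) (g : lieAlgType R) (J : 'End(g)).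
Hypothesis cJ : complex_structure J.
Implicit Types (A : {vspace g}) (a : cdual g) (X Y : g).

Let JJ X : J (J X) = - X. Proof. by case: cJ => JJ _; exact: JJ. Qed.

Definition J_stable A := forall X, X \in A -> J X \in A.

(** The (1,0)-forms that vanish on [A], that is, the (1,0)-forms of the
    quotient by [A] when [A] is a [J]-stable ideal. *)
Definition ann10 A : {vspace cdual g} := (forms10 J :&: quot_cdual A)%VS.

Lemma ann10P A a :
  a \in ann10 A <->
  (forall X, ev a (J X) = 'i%C * ev a X) /\ (forall X, X \in A -> ev a X = 0).
Proof.
rewrite /ann10 memv_cap; split=> [/andP[/forms10P aJ /quot_cdualP aA] //|].
by case=> aJ aA; apply/andP; split; [apply/forms10P | apply/quot_cdualP].
Qed.

Lemma ann10_J A a X : a \in ann10 A -> ev a (J X) = 'i%C * ev a X.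
Proof. by case/ann10P. Qed.

Lemma ann10_0 A a X : a \in ann10 A -> X \in A -> ev a X = 0.
Proof. by case/ann10P => _; apply. Qed.

Lemma ann10_sub A B : (A <= B)%VS -> (ann10 B <= ann10 A)%VS.
Proof.
move=> /subvP AB; apply/subvP => a /ann10P[aJ aB].
by apply/ann10P; split=> // X /AB; exact: aB.
Qed.

(** A form that vanishes on [A] splits as [a = (a - i aJ)/2 + (a + i aJ)/2], and
    both halves vanish on [A] when [A] is [J]-stable. *)
Lemma quot_cdual_split A : J_stable A ->
  quot_cdual A = (ann10 A + conj_vspace (ann10 A))%VS.
Proof.
move=> JA; apply/eqP; rewrite eqEsubv; apply/andP; split; last first.
  rewrite subv_add /ann10 capvSr /=; apply/subvP => a.
  rewrite mem_conj_vspace => /ann10P[_ aA]; apply/quot_cdualP => X XA.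
  by rewrite -[a]conjvK cdual_eval_conj aA ?conjc0.
apply/subvP => a /quot_cdualP aA.
pose aJ := complexify (pullback R^o J) a.
have aJE X : ev aJ X = ev a (J X).
  by rewrite /aJ complexifyE /cdual_eval /= !pullbackE.
have n2 : (2 : R[i]) != 0 by rewrite Num.Theory.pnatr_eq0.
have -> : a = 2^-1 *: (a - 'i%C *: aJ) + 2^-1 *: (a + 'i%C *: aJ).
  rewrite -scalerDr addrACA addNr addr0 -mulr2n -[a *+ 2]scaler_nat scalerA.
  by rewrite mulVf // scale1r.
apply: memv_add; apply: memvZ.
  apply/ann10P; split=> X => [|XA];
    rewrite !(cdual_evalD, cdual_evalN, cdual_evalZ) !aJE.
    by rewrite JJ cdual_evalNr; ring: (mulii R).
  by rewrite !aA ?JA //; ring.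
rewrite mem_conj_vspace; apply/ann10P; split=> X => [|XA];
  rewrite !cdual_eval_conj.
  rewrite -[RHS]conjcK conjc_iM conjcK; congr conjc.
  rewrite !(cdual_evalD, cdual_evalZ) !aJE.
  by rewrite JJ cdual_evalNr; ring: (mulii R).
by rewrite cdual_evalD cdual_evalZ aJE !aA ?JA // mulr0 addr0 conjc0.
Qed.

(** On forms of type (2,0), (1,1) and (0,2) this operator is multiplication by
    0, 0 and -4 respectively, whereas it kills [d a] for a (1,0)-form [a] by
    integrability of [J]. *)
Definition nijenhuis_form (b : cbilform g) X Y : R[i] :=
  bev b (J X) (J Y) - 'i%C * bev b (J X) Y - 'i%C * bev b X (J Y) - bev b X Y.

Lemma nijenhuis_form_lin c b b' X Y :
  nijenhuis_form (c *: b + b') X Y =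
  c * nijenhuis_form b X Y + nijenhuis_form b' X Y.
Proof.
by rewrite /nijenhuis_form !(cbilform_evalD, cbilform_evalZ); ring.
Qed.

Lemma nijenhuis_form_d a X Y :
  a \in forms10 J -> nijenhuis_form (ce_d g a) X Y = 0.
Proof.
move=> /forms10P aJ; rewrite /nijenhuis_form !ce_dE.
have [_ ->] := cJ; rewrite !cdual_evalDr !aJ.
by ring.
Qed.

Lemma conj_ann10_J A a X :
  a \in conj_vspace (ann10 A) -> ev a (J X) = - 'i%C * ev a X.
Proof.
rewrite mem_conj_vspace => /(ann10_J X); rewrite !cdual_eval_conj => aJ.
by rewrite -[LHS]conjcK aJ conjc_iM conjcK.
Qed.

Lemma conj_ann10_0 A a X : a \in conj_vspace (ann10 A) -> X \in A -> ev a X = 0.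
Proof.
rewrite mem_conj_vspace => /ann10_0 aA /aA; rewrite cdual_eval_conj => a0.
by rewrite -[LHS]conjcK a0 conjc0.
Qed.

Lemma nijenhuis_form_wedge_span A b X Y :
  b \in wedge_span (ann10 A) -> nijenhuis_form b X Y = 0.
Proof.
pose P (c : cbilform g) := nijenhuis_form c X Y = 0.
have N0 : nijenhuis_form 0 X Y = 0.
  by rewrite /nijenhuis_form !cbilform_eval0; ring.
have Nlin c (b1 b2 : cbilform g) : nijenhuis_form b1 X Y = 0 ->
    nijenhuis_form b2 X Y = 0 -> nijenhuis_form (c *: b1 + b2) X Y = 0.
  by rewrite nijenhuis_form_lin => -> ->; rewrite mulr0 addr0.
case/memv_addP => b1 b1U [b2 b2U ->]; rewrite -[b1]scale1r; apply: (Nlin).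
  move: b1 b1U; apply: (bilspan_wedge_ind (P := P) N0 Nlin) => a a' aU a'U.
  rewrite /P /nijenhuis_form /= !wedgeE !(ann10_J _ aU) !(ann10_J _ a'U).
  by ring: (mulii R).
move: b2 b2U; apply: (bilspan_wedge_ind (P := P) N0 Nlin) => a a' aU a'U.
rewrite /P /nijenhuis_form /= !wedgeE !(ann10_J _ aU) !(conj_ann10_J _ a'U).
by ring: (mulii R).
Qed.

Lemma nijenhuis_form_02 A b X Y :
  b \in bilspan (@wedge R g) (conj_vspace (ann10 A)) (conj_vspace (ann10 A)) ->
  nijenhuis_form b X Y = - 4 * bev b X Y.
Proof.
move: b; apply: bilspan_wedge_ind => [|c x y Hx Hy|a a' aU a'U].
- by rewrite /nijenhuis_form !cbilform_eval0; ring.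
- by rewrite nijenhuis_form_lin Hx Hy cbilform_evalD cbilform_evalZ; ring.
rewrite /nijenhuis_form /= !wedgeE !(conj_ann10_J _ aU) !(conj_ann10_J _ a'U).
by ring: (mulii R).
Qed.

Lemma wedge_span_vanish A b X Y :
  b \in wedge_span (ann10 A) -> X \in A -> bev b X Y = 0.
Proof.
move=> bU XA; move: bU; pose P (c : cbilform g) := bev c X Y = 0.
have b0 : bev (0 : cbilform g) X Y = 0 by exact: cbilform_eval0.
have blin c (b1 b2 : cbilform g) : bev b1 X Y = 0 ->
    bev b2 X Y = 0 -> bev (c *: b1 + b2) X Y = 0.
  by rewrite cbilform_evalD cbilform_evalZ => -> ->; rewrite mulr0 addr0.
case/memv_addP => b1 b1U [b2 b2U ->]; rewrite -[b1]scale1r; apply: (blin).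
  move: b1 b1U; apply: (bilspan_wedge_ind (P := P) b0 blin) => a a' aU a'U.
  by rewrite /P wedgeE (ann10_0 aU XA) (ann10_0 a'U XA) mul0r mulr0 subr0.
move: b2 b2U; apply: (bilspan_wedge_ind (P := P) b0 blin) => a a' aU a'U.
by rewrite /P wedgeE (ann10_0 aU XA) (conj_ann10_0 a'U XA) mul0r mulr0 subr0.
Qed.

Lemma ce_d_alternating a X Y : bev (ce_d g a) X Y = - bev (ce_d g a) Y X.
Proof. by rewrite !ce_dE lieC cdual_evalNr. Qed.

(** If [d a] vanishes on [A], it is a two-form in the forms that vanish on [A];
    splitting these by type leaves a (2,0), a (1,1) and a (0,2) part, and the
    last one is zero by integrability of [J]. *)
Lemma ce_d_mem_wedge_span A a :
  J_stable A -> a \in forms10 J ->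
  (forall X Y, X \in A -> ev a (lie X Y) = 0) ->
  ce_d g a \in wedge_span (ann10 A).
Proof.
move=> JA a10 aA; set U := ann10 A.
have : ce_d g a \in bilspan (@wedge R g) (quot_cdual A) (quot_cdual A).
  apply: alternating_mem_bilspan => [X Y|X Y XA]; first exact: ce_d_alternating.
  by rewrite ce_dE aA ?oppr0.
have /subvP sub : (bilspan (@wedge R g) (quot_cdual A) (quot_cdual A) <=
    wedge_span U + bilspan (@wedge R g) (conj_vspace U) (conj_vspace U))%VS.
  apply: bilspan_wedge_sub => x y.
  rewrite quot_cdual_split // => /memv_addP[x1 x1U [x2 x2U ->]].
  case/memv_addP => y1 y1U [y2 y2U ->].
  have -> : wedge (x1 + x2) (y1 + y2) =
      wedge x1 y1 + (wedge x1 y2 + wedge (- y1) x2) + wedge x2 y2.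
    apply: cbilform_inj => X Y.
    by rewrite !(cbilform_evalD, wedgeE, cdual_evalD, cdual_evalN); ring.
  apply: memv_add; last exact: memv_bilspan_wedge.
  apply: memv_add; first exact: memv_bilspan_wedge.
  by apply: memvD; apply: memv_bilspan_wedge => //; rewrite memvN.
case/sub/memv_addP => b bU [b' b'U dE]; rewrite dE.
suff -> : b' = 0 by rewrite addr0.
apply: cbilform_inj => X Y.
have := nijenhuis_form_d X Y a10; rewrite dE -[b]scale1r nijenhuis_form_lin.
rewrite (nijenhuis_form_wedge_span _ _ bU) (nijenhuis_form_02 _ _ b'U).
rewrite mulr0 add0r => /eqP; rewrite mulf_eq0 oppr_eq0.
rewrite Num.Theory.pnatr_eq0 /= => /eqP ->.
by rewrite cbilform_eval0.
Qed.

(** If [X] is not in [A], some real form vanishes on [A] but not at [X]. One of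
    its two components in [quot_cdual_split] is then nonzero at [X], and it is a
    (1,0)-form or the conjugate of one. *)
Lemma ann10_separates A X :
  J_stable A -> (forall a, a \in ann10 A -> ev a X = 0) -> X \in A.
Proof.
move=> JA aX; apply/contraT => XA.
have aX0 a : a \in quot_cdual A -> ev a X = 0.
  rewrite quot_cdual_split // => /memv_addP[b bU [b' b'U ->]].
  rewrite cdual_evalD aX // add0r -[b']conjvK cdual_eval_conj aX ?conjc0 //.
  by rewrite -mem_conj_vspace.
case/negP: XA; rewrite -(lker_quotv_proj A) memv_ker.
rewrite (coord_vbasis (memvf (quotv_proj A X))) big1 ?eqxx // => i _.
pose f : 'Hom(quotv A, R^o) :=
  linfun (coord (vbasis {:quotv A}) i : quotv A -> R^o).
have : (pullback R^o (quotv_proj A) f, 0) \in quot_cdual A.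
  apply/quot_cdualP => Y; rewrite -{1}(lker_quotv_proj A) memv_ker => /eqP Y0.
  by rewrite /cdual_eval /= pullbackE Y0 linear0 lfunE.
move/aX0; rewrite /cdual_eval /= pullbackE /f lfunE /= => -[-> _].
by rewrite scale0r.
Qed.

(** Composition with [J] is multiplication by [i] on the (1,0)-forms and by [-i]
    on their conjugates. *)
Lemma conj_forms10_disjoint (U : {vspace cdual g}) :
  (U <= forms10 J)%VS -> (U :&: conj_vspace U = 0)%VS.
Proof.
move=> /subvP U10; apply/eqP; rewrite -subv0; apply/subvP => a.
rewrite memv_cap mem_conj_vspace => /andP[/U10 /forms10P aJ /U10 /forms10P caJ].
rewrite memv0; apply/eqP/cdual_inj => X; rewrite cdual_eval0.
have := caJ X; rewrite !cdual_eval_conj aJ conjc_iM => /eqP.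
rewrite mulNr eq_sym -subr_eq0 opprK -mulr2n -mulrnAl mulf_eq0.
rewrite -mulr_natl mulf_eq0 Num.Theory.pnatr_eq0 orFb.
rewrite (_ : ('i%C == 0 :> R[i]) = false); last first.
  by rewrite eq_complex /= oner_eq0 andbF.
by move=> /eqP c0; rewrite -[LHS]conjcK c0 conjc0.
Qed.

Lemma dim_conj_vspace (U : {vspace cdual g}) : \dim (conj_vspace U) = \dim U.
Proof.
have le_dim (W : {vspace cdual g}) : (\dim (conj_vspace W) <= \dim W)%N.
  by apply: leq_trans (dim_span _) _; rewrite size_map size_tuple.
apply/eqP; rewrite eqn_leq le_dim /=.
suff {1}-> : U = conj_vspace (conj_vspace U) by exact: le_dim.
by apply/vspaceP => a; rewrite !mem_conj_vspace conjvK.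
Qed.

Lemma dim_forms10_le : (\dim (forms10 J) <= dimC g)%N.
Proof.
have := dimvS (subvf (forms10 J + conj_vspace (forms10 J))%VS).
rewrite dimv_disjoint_sum ?conj_forms10_disjoint // dim_conj_vspace addnn.
rewrite /dimC !dimvf => le2.
rewrite -[\dim _]doubleK; apply: half_leq; apply: leq_trans le2 _.
have -> : dim (cdual g) = (dim g * 1)%N by [].
by rewrite muln1.
Qed.

(** * The ascending series *)

Lemma asc_J k : J_stable (asc J k).
Proof.
case: k => [|k] X; first by rewrite !memv0 => /eqP->; rewrite linear0.
move=> /ascSP XA; apply/ascSP => Y; have [X1 X2] := XA Y.
by split=> //; rewrite JJ linearNl memvN.
Qed.

Lemma asc_leS k : (asc J k <= asc J k.+1)%VS.
Proof.
elim: k => [|k IHk]; first exact: sub0v.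
apply/subvP => X /ascSP XA; apply/ascSP => Y.
by have [X1 X2] := XA Y; split; apply: (subvP IHk).
Qed.

Lemma asc_le k l : (k <= l)%N -> (asc J k <= asc J l)%VS.
Proof.
move=> /subnK <-; elim: (l - k)%N => // m IHm.
exact: subv_trans IHm (asc_leS _).
Qed.

Lemma asc_stationary m k :
  asc J m = asc J m.+1 -> (m <= k)%N -> asc J k = asc J m.
Proof.
move=> st /subnK <-; elim: (k - m)%N => // j IHj.
by rewrite [RHS]st /= -/(asc J (j + m)) IHj.
Qed.

Lemma nu_full : nilpotent_complex_structure J -> asc J (nu J) = {:g}%VS.
Proof.
by rewrite /nu; case: pselect => // ex _; case: ex_minnP => m /eqP.
Qed.

Lemma nu_min t : asc J t = {:g}%VS -> (nu J <= t)%N.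
Proof.
move=> tf; rewrite /nu; case: pselect => // ex; case: ex_minnP => m _.
by apply; rewrite tf.
Qed.

(** Once two consecutive terms agree, the series is constant. *)
Lemma asc_lt_nu m : nilpotent_complex_structure J -> (m < nu J)%N ->
  ~~ (asc J m.+1 <= asc J m)%VS.
Proof.
move=> nJ mnu; apply/negP => sub.
have st : asc J m = asc J m.+1 by apply/eqP; rewrite eqEsubv asc_leS.
have := nu_full nJ; rewrite (asc_stationary st (ltnW mnu)) => /nu_min.
by rewrite leqNgt mnu.
Qed.

(** The [k]-th term of the lower central series lies in [asc J (t - k)]. *)
Lemma nilpotent_lie_of_asc t : asc J t = {:g}%VS -> nilpotent_lie g.
Proof.
move=> tf; exists t; apply/eqP; rewrite -subv0.
suff H k : (k <= t)%N -> (lower_central g k <= asc J (t - k))%VS.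
  by have := H t (leqnn t); rewrite subnn.
elim: k => [|k IHk] kt; first by rewrite subn0 tf subvf.
apply: (iffLR (bilspan_subP (@lie R g) _ _ _)) => X Y _ Yk.
have := subvP (IHk (ltnW kt)) Y Yk; rewrite -(subnSK kt) => /ascSP/(_ X)[H _].
by rewrite /= lieC memvN.
Qed.

(** * The flag of annihilators *)

Lemma ann10_0v : ann10 0 = forms10 J.
Proof.
apply/vspaceP => a; rewrite /ann10 memv_cap andb_idr // => _.
apply/quot_cdualP => X; rewrite memv0 => /eqP->.
by rewrite /cdual_eval !linear0.
Qed.

Lemma ann10_fullv : ann10 {:g} = 0%VS.
Proof.
apply/eqP; rewrite -subv0; apply/subvP => a /ann10P[_ a0].
by rewrite memv0; apply/eqP/cdual_inj => X; rewrite cdual_eval0 a0 ?memvf.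
Qed.

(** The (1,0)-forms of the successive quotients of [g] by the ideals
    [asc J m], numbered so that they increase with [k]. *)
Definition flag k : {vspace cdual g} := ann10 (asc J (dimC g - k)).

Section Maximal.
Hypothesis maxN : MaxN J.
Let n := dimC g.

Let nJ : nilpotent_complex_structure J. Proof. by case: maxN. Qed.
Let nuE : nu J = n. Proof. by case: maxN. Qed.

Lemma flag0 : flag 0 = 0%VS.
Proof. by rewrite /flag subn0 -/n -nuE nu_full // ann10_fullv. Qed.

Lemma flag_top : flag n = forms10 J.
Proof. by rewrite /flag subnn ann10_0v. Qed.

Lemma flag_leS k : (flag k <= flag k.+1)%VS.
Proof. by apply/ann10_sub/asc_le; rewrite leq_sub2l. Qed.

Lemma flag_le k l : (k <= l)%N -> (flag k <= flag l)%VS.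
Proof. by move=> kl; apply/ann10_sub/asc_le; rewrite leq_sub2l. Qed.

(** A vector of [asc J (n - k)] outside [asc J (n - k.+1)] is separated from the
    latter by a form of [flag k.+1], which then is not in [flag k]. *)
Lemma flag_lt k : (k < n)%N -> ~~ (flag k.+1 <= flag k)%VS.
Proof.
move=> kn; have : (n - k.+1 < nu J)%N by rewrite nuE subnSK ?leq_subr.
move=> /(asc_lt_nu nJ); apply: contra => sub; rewrite subnSK //.
apply/subvP => X Xk; apply: ann10_separates => [|a /(subvP sub) ak].
  exact: asc_J.
exact: ann10_0 ak Xk.
Qed.

Lemma flag_lt_dim j d :
  (j + d <= n)%N -> (\dim (flag j) + d <= \dim (flag (j + d)))%N.
Proof.
elim: d => [|d IHd] jd; first by rewrite !addn0.
rewrite !addnS; rewrite addnS in jd.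
apply: leq_ltn_trans (IHd (ltnW jd)) _.
rewrite ltn_neqAle dimvS ?flag_leS // andbT.
apply: contra (flag_lt jd) => dimE.
have /eqP <- // : flag (j + d) == flag (j + d).+1.
by rewrite eqEdim flag_leS (eqP dimE) leqnn.
Qed.

(** The flag has [n] strict inclusions in a space of dimension at most [n]. *)
Lemma dim_flag k : (k <= n)%N -> \dim (flag k) = k.
Proof.
move=> kn; apply/eqP; rewrite eqn_leq; apply/andP; split.
  have := @flag_lt_dim k (n - k); rewrite subnKC // flag_top => /(_ (leqnn _)).
  move=> le_top; have := leq_trans le_top dim_forms10_le.
  by rewrite -[dimC g](subnKC kn) leq_add2r.
by have := @flag_lt_dim 0 k kn; rewrite flag0 dimv0 !add0n.
Qed.

Lemma flag_line k a : (k < n)%N -> a \in flag k.+1 -> a \notin flag k ->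
  flag k.+1 = (flag k + <[a]>)%VS.
Proof.
move=> kn ak nak; apply/esym/eqP; rewrite eqEdim subv_add flag_leS -memvE ak /=.
rewrite dim_flag // -{1}(dim_flag (ltnW kn)) ltn_neqAle dimvS ?addvSl // andbT.
apply: contra nak => /eqP dimE.
have /eqP -> : flag k == (flag k + <[a]>)%VS.
  by rewrite eqEdim addvSl -dimE leqnn.
by rewrite memvE addvSr.
Qed.

(** The bracket of [asc J (n - k)] with [g] lies in [asc J (n - k.+1)], where
    [a] vanishes. *)
Lemma ce_d_flag k a :
  (k < n)%N -> a \in flag k.+1 -> ce_d g a \in wedge_span (flag k).
Proof.
move=> kn ak; have a10 : a \in forms10 J by apply: (subvP (capvSl _ _)) ak.
apply: ce_d_mem_wedge_span => // [|X Y]; first exact: asc_J.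
rewrite -/n -(subnSK kn) => /ascSP/(_ Y)[XY _].
exact: ann10_0 ak XY.
Qed.

(** As [flag p.+2] is spanned by [a] and [flag p.+1], the vanishing of [d a] on
    [asc J (n - p)] would make the differentials of all forms of [flag p.+2]
    vanish there. The bracket of [asc J (n - p)] with [g] would then lie in
    [asc J (n - p.+2)], and [asc J (n - p)] in [asc J (n - p.+1)]. *)
Lemma flag_d_nondegenerate p a : (p.+1 < n)%N ->
  a \in flag p.+2 -> a \notin flag p.+1 ->
  ~ (forall X Y, X \in asc J (n - p) -> ev a (lie X Y) = 0).
Proof.
move=> pn ap nap a0.
have nu_p : (n - p.+1 < nu J)%N by rewrite nuE subnSK ?leq_subr // ltnW.
have /negP := asc_lt_nu nJ nu_p; apply.
rewrite subnSK ?(ltnW pn) //; apply/subvP => X Xp; rewrite -(subnSK pn).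
have H Z Y : Z \in asc J (n - p) -> lie Z Y \in asc J (n - p.+2).
  move=> Zp; apply: ann10_separates => [|b]; first exact: asc_J.
  rewrite -[ann10 _]/(flag p.+2) (flag_line pn ap nap).
  case/memv_addP => b1 b1p [b2 /vlineP[c ->] ->].
  rewrite cdual_evalD cdual_evalZ a0 // mulr0 addr0.
  apply: oppr_inj; rewrite oppr0 -ce_dE.
  by apply: wedge_span_vanish (ce_d_flag (ltnW pn) b1p) _.
by apply/ascSP => Y; split; apply: H => //; apply: asc_J.
Qed.

(** A (1,0)-form [a] with [d a] in [wedge_span (flag k)] lies in [flag n]. As
    [d a] vanishes on [asc J (n - k)], [flag_d_nondegenerate] moves [a] down the
    flag one step at a time until it reaches [flag k.+1]. *)
Lemma Wseries_flag k : (k <= n)%N -> Wseries J k = flag k.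
Proof.
elim: k => [|k IHk] kn; first by rewrite flag0.
apply/vspaceP => a /=; rewrite IHk ?(ltnW kn) // -/(wedge_span _).
rewrite memv_cap -memv_preim.
apply/andP/idP => [[a10 da]|ak]; last first.
  by split; [move: ak; rewrite memv_cap => /andP[] | exact: ce_d_flag].
have da0 X Y : X \in asc J (n - k) -> ev a (lie X Y) = 0.
  move=> Xk; apply: oppr_inj; rewrite oppr0 -ce_dE.
  exact: wedge_span_vanish da Xk.
have : a \in flag n by rewrite flag_top.
suff H m : (k < m <= n)%N -> a \in flag m -> a \in flag k.+1.
  by apply: H; rewrite kn /=.
elim: m => // m IHm /andP[km mn] am.
move: km; rewrite ltnS leq_eqVlt => /orP[/eqP km|km]; first by rewrite km.
apply: IHm; first by rewrite km ltnW.
case: m km mn am => // p kp pn ap; apply/contraT => nap; exfalso.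
apply: (flag_d_nondegenerate pn ap nap) => X Y Xp; apply: da0.
by apply: subvP Xp; apply: asc_le; rewrite leq_sub2l.
Qed.

Lemma quot_cdual_asc_Wseries k : (k <= nu J)%N ->
  quot_cdual (asc J (nu J - k)) =
    (Wseries J k + conj_vspace (Wseries J k))%VS /\
  directv (Wseries J k + conj_vspace (Wseries J k)).
Proof.
rewrite nuE => kn; rewrite Wseries_flag //; split.
  by rewrite quot_cdual_split //; exact: asc_J.
by apply/directv_addP/conj_forms10_disjoint/capvSl.
Qed.

Definition flag_basis k := vpick (flag k.+1 :\: flag k)%VS.

Lemma flag_basis_mem k : flag_basis k \in flag k.+1.
Proof. by apply: (subvP (diffvSl _ _)); exact: memv_pick. Qed.

Lemma flag_basis_notin k : (k < n)%N -> flag_basis k \notin flag k.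
Proof.
move=> kn; apply/negP => wk.
have : flag_basis k \in ((flag k.+1 :\: flag k) :&: flag k)%VS.
  by rewrite memv_cap memv_pick.
rewrite capv_diff memv0 vpick0 => /eqP d0.
case/negP: (flag_lt kn); rewrite -(addv_diff_cap (flag k.+1) (flag k)) d0 add0v.
exact: capvSr.
Qed.

Lemma flag_sum k : (k <= n)%N -> flag k = (\sum_(i < k) <[flag_basis i]>)%VS.
Proof.
elim: k => [|k IHk] kn; first by rewrite flag0 big_ord0.
rewrite big_ord_recr /= -IHk ?(ltnW kn) //.
by apply: flag_line; rewrite ?flag_basis_mem ?flag_basis_notin.
Qed.

Lemma flag_sum_ord (k : 'I_n) :
  flag k = (\sum_(i < n | (i < k)%N) <[flag_basis i]>)%VS.
Proof.
rewrite flag_sum ?(ltnW (ltn_ord k)) //.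
by rewrite (big_ord_widen n (fun i => <[flag_basis i]>%VS)) // ltnW.
Qed.

Lemma basis_flag : basis_of (forms10 J) [tuple flag_basis i | i < n].
Proof.
rewrite basisEdim size_tuple -flag_top dim_flag // leqnn andbT flag_sum //.
apply/subv_sumP => i _; rewrite -memvE; apply: memv_span.
by apply/mapP; exists i; rewrite ?mem_enum.
Qed.
End Maximal.
End Types.

(** * Extraction of coefficients *)

Section SumsOfLines.
Variables (K : fieldType) (V : vectType K).

Lemma memv_sum_lines (I : finType) (P : pred I) (u : I -> V) v :
  v \in (\sum_(i | P i) <[u i]>)%VS ->
  exists c : I -> K, v = \sum_(i | P i) c i *: u i.
Proof.
case/memv_sumP => vs vsP ->.
have [c cE] : exists c : I -> K, forall i, P i -> vs i = c i *: u i.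
  apply: (fin_all_exists (P := fun i c => P i -> vs i = c *: u i)) => i.
  case: (boolP (P i)) => [/vsP /vlineP[c ->]|nP].
    by exists c.
  by exists 0.
by exists c; apply: eq_bigr.
Qed.

Lemma memv_sum2_lines (I I' : finType) (P : pred I) (Q : I -> pred I')
    (u : I -> I' -> V) v :
  v \in (\sum_(j | P j) \sum_(i | Q j i) <[u j i]>)%VS ->
  exists c : I -> I' -> K, v = \sum_(j | P j) \sum_(i | Q j i) c j i *: u j i.
Proof.
case/memv_sumP => vs vsP ->.
have [c cE] : exists c : I -> I' -> K, forall j, P j ->
    vs j = \sum_(i | Q j i) c j i *: u j i.
  pose eqn j c := P j -> vs j = \sum_(i | Q j i) c i *: u j i.
  apply: (fin_all_exists (P := eqn)) => j; rewrite /eqn.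
  case: (boolP (P j)) => [/vsP|nP].
    by case/memv_sum_lines => c ->; exists c.
  by exists (fun=> 0).
by exists c; apply: eq_bigr.
Qed.
End SumsOfLines.

Section WedgeOfLines.
Variables (R : rcfType) (V : vectType R) (n k : nat) (w : 'I_n -> cdual V).
Let Wk := (\sum_(i < n | (i < k)%N) <[w i]>)%VS.

Let wedge_sum (c d : 'I_n -> R[i]) (w' : 'I_n -> cdual V) :
  wedge (\sum_(i < n | (i < k)%N) c i *: w i)
        (\sum_(j < n | (j < k)%N) d j *: w' j) =
  \sum_(i < n | (i < k)%N) \sum_(j < n | (j < k)%N)
     (c i * d j) *: wedge (w i) (w' j).
Proof.
apply: cbilform_inj => X Y; rewrite wedgeE !cbilform_eval_sum !cdual_eval_sum.
rewrite !mulr_suml -sumrB; apply: eq_bigr => i _; rewrite cbilform_eval_sum.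
rewrite !mulr_sumr -sumrB; apply: eq_bigr => j _.
by rewrite cbilform_evalZ wedgeE !cdual_evalZ; ring.
Qed.

Lemma wedge_span_lines :
  (wedge_span Wk <=
   \sum_(j < n | (j < k)%N) \sum_(i < n | (i < j)%N) <[wedge (w i) (w j)]> +
   \sum_(i < n | (i < k)%N) \sum_(j < n | (j < k)%N)
      <[wedge (w i) (conjv (w j))]>)%VS.
Proof.
apply: addvS; apply: bilspan_wedge_sub => a b.
  case/memv_sum_lines => c -> /memv_sum_lines[d ->].
  rewrite wedge_sum; apply: memv_suml => i ik; apply: memv_suml => j jk.
  apply: memvZ; case: (ltngtP i j) => [ij|ji|ij].
  - rewrite memvE; apply: (sumv_sup j) => //.
    exact: (sumv_sup i).
  - rewrite wedgeC memvN; rewrite memvE; apply: (sumv_sup i) => //.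
    exact: (sumv_sup j).
  have -> : wedge (w i) (w j) = 0.
    rewrite (val_inj ij).
    by apply: cbilform_inj => X Y; rewrite cbilform_eval0 wedgeE; ring.
  exact: mem0v.
case/memv_sum_lines => c ->; rewrite mem_conj_vspace => /memv_sum_lines[d dE].
have -> : b = \sum_(j < n | (j < k)%N) conjc (d j) *: conjv (w j).
  by rewrite -[LHS]conjvK dE conjv_sum; apply: eq_bigr => j _; rewrite conjvZ.
rewrite wedge_sum; apply: memv_suml => i ik; apply: memv_suml => j jk.
apply: memvZ; rewrite memvE; apply: (sumv_sup i) => //.
exact: (sumv_sup j).
Qed.
End WedgeOfLines.

(** * Structure equations *)

Section StructureEquations.
Variables (R : rcfType) (g : lieAlgType R) (n : nat) (w : n.-tuple (cdual g)).
Variables (A B : 'I_n -> 'I_n -> 'I_n -> R[i]).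

Definition structure_equation (k : 'I_n) : Prop :=
  ce_d g (tnth w k) =
    \sum_(j < n | (j < k)%N) \sum_(i < n | (i < j)%N)
       A k i j *: wedge (tnth w i) (tnth w j) +
    \sum_(i < n | (i < k)%N) \sum_(j < n | (j < k)%N)
       B k i j *: wedge (tnth w i) (conjv (tnth w j)).

(** Indices start at 0, so [l] is the largest index in the equation for
    [k = l.+1]. *)
Definition top_index_occurs : Prop :=
  forall k l : 'I_n, k = l.+1 :> nat ->
    [\/ exists2 i : 'I_n, (i < l)%N & A k i l != 0,
        exists2 j : 'I_n, (j <= l)%N & B k l j != 0
      | exists2 i : 'I_n, (i < l)%N & B k i l != 0].

Lemma structure_equationE k : structure_equation k ->
  forall X Y, - ev (tnth w k) (lie X Y) =
    \sum_(j < n | (j < k)%N) \sum_(i < n | (i < j)%N) A k i j *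
      (ev (tnth w i) X * ev (tnth w j) Y - ev (tnth w i) Y * ev (tnth w j) X) +
    \sum_(i < n | (i < k)%N) \sum_(j < n | (j < k)%N) B k i j *
      (ev (tnth w i) X * conjc (ev (tnth w j) Y)
       - ev (tnth w i) Y * conjc (ev (tnth w j) X)).
Proof.
move=> eqk X Y; rewrite -ce_dE eqk cbilform_evalD !cbilform_eval_sum.
by congr (_ + _); apply: eq_bigr => j _; rewrite cbilform_eval_sum;
  apply: eq_bigr => i _; rewrite cbilform_evalZ wedgeE ?cdual_eval_conj.
Qed.

Let free_coef (P : pred 'I_n) (c : 'I_n -> R[i]) : free w ->
  \sum_(i < n | P i) c i *: tnth w i = 0 -> forall i, P i -> c i = 0.
Proof.
move=> /freeP free_w sum0 i Pi.
have := free_w (fun i => if P i then c i else 0) _ i; rewrite Pi; apply.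
rewrite -[RHS]sum0 [in RHS]big_mkcond; apply: eq_bigr => j _.
by rewrite (tnth_nth 0); case: (P j); rewrite ?scale0r.
Qed.

Let big_single (I : finType) (P : pred I) (F : I -> R[i]) l :
  P l -> (forall i, P i -> i != l -> F i = 0) -> \sum_(i | P i) F i = F l.
Proof.
by move=> Pl F0; rewrite (bigD1 l) //= big1 ?addr0 // => i /andP[]; apply: F0.
Qed.

Lemma structure_equation_vanish k X Y : structure_equation k ->
  (forall i : 'I_n, (i < k)%N -> ev (tnth w i) X = 0) ->
  ev (tnth w k) (lie X Y) = 0.
Proof.
move=> /structure_equationE/(_ X Y) eqk X0.
apply: oppr_inj; rewrite eqk oppr0.
rewrite big1 ?add0r => [|j jk]; last first.
  rewrite big1 // => i ij; rewrite !X0 ?(ltn_trans ij) //.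
  by rewrite mul0r mulr0 subr0 mulr0.
rewrite big1 // => i ik; rewrite big1 // => j jk.
by rewrite !X0 // conjc0 mul0r mulr0 subr0 mulr0.
Qed.

Lemma top_index_absent_vanish (k l : 'I_n) X Y :
  structure_equation k -> k = l.+1 :> nat ->
  (forall i : 'I_n, (i < l)%N -> A k i l = 0) ->
  (forall j : 'I_n, (j <= l)%N -> B k l j = 0) ->
  (forall i : 'I_n, (i < l)%N -> B k i l = 0) ->
  (forall i : 'I_n, (i < l)%N -> ev (tnth w i) X = 0) ->
  ev (tnth w k) (lie X Y) = 0.
Proof.
move=> /structure_equationE/(_ X Y) eqk kl A0 Bl0 B0 X0.
apply: oppr_inj; rewrite eqk oppr0 kl.
rewrite big1 ?add0r => [|j]; last first.
  rewrite ltnS leq_eqVlt => jl; rewrite big1 // => i ij.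
  case/orP: jl => [/eqP/val_inj jl|jl]; first by rewrite jl A0 ?mul0r // -jl.
  by rewrite !X0 ?(ltn_trans ij) // mul0r mulr0 subr0 mulr0.
rewrite big1 // => i; rewrite ltnS leq_eqVlt => /orP[/eqP/val_inj->|il].
  by rewrite big1 // => j jl; rewrite Bl0 ?mul0r.
rewrite big1 // => j; rewrite ltnS leq_eqVlt => /orP[/eqP/val_inj->|jl].
  by rewrite B0 ?mul0r.
by rewrite !X0 // conjc0 mul0r mulr0 subr0 mulr0.
Qed.

(** The contractions with [X] and [J X] are two independent linear equations in
    [p1 - q] and [p2]. *)
Let contraction_eq0 (x p1 p2 q : R[i]) : x != 0 ->
  0 = x * p1 + conjc x * p2 - x * q ->
  0 = 'i%C * x * p1 + - 'i%C * conjc x * p2 - 'i%C * x * q ->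
  p1 = q /\ p2 = 0.
Proof.
move=> x0; have : conjc x != 0.
  by apply: contra_neq x0 => c0; rewrite -[x]conjcK c0 conjc0.
have n2 : (2 : R[i]) != 0 by rewrite Num.Theory.pnatr_eq0.
move: (conjc x) => y y0 e1 e2; split.
  have /eqP : 0 - 'i%C * 0 = 2 * x * (p1 - q).
    by rewrite {1}e1 {1}e2; ring: (mulii R).
  rewrite mulr0 subr0 eq_sym !mulf_eq0 (negbTE n2) (negbTE x0) /= subr_eq0.
  by move/eqP.
have /eqP : 0 + 'i%C * 0 = 2 * y * p2.
  by rewrite {1}e1 {1}e2; ring: (mulii R).
rewrite mulr0 addr0 eq_sym !mulf_eq0 (negbTE n2) (negbTE y0) /=.
by move/eqP.
Qed.

(** Put [x = w_l(X)]. As [X] is killed by the forms before [w_l], its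
    contraction with [d w_k] is, up to sign, [x P1 + conj(x) P2 - x conj(Q)],
    where [P1], [P2] and [Q] are combinations of the [w_i] with coefficients
    [A k i l], [B k i l] and the conjugates of [B k l j]. For [J X] the scalar
    [x] becomes [i x], which separates [P2] from the rest; evaluating at [J Y]
    separates [P1] from the conjugate of [Q]. So if [x <> 0], all three vanish,
    and with them all the coefficients at the index [l]. *)
Lemma top_index_vanish (J : 'End(g)) (k l : 'I_n) X :
  (forall i Y, ev (tnth w i) (J Y) = 'i%C * ev (tnth w i) Y) ->
  free w -> top_index_occurs -> structure_equation k -> k = l.+1 :> nat ->
  (forall i : 'I_n, (i < l)%N -> ev (tnth w i) X = 0) ->
  (forall Y, ev (tnth w k) (lie X Y) = 0) ->
  (forall Y, ev (tnth w k) (lie (J X) Y) = 0) ->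
  ev (tnth w l) X = 0.
Proof.
move=> wJ free_w nondeg eqk kl X0 dX dJX; set x := ev (tnth w l) X.
have [//|x0] := eqVneq x 0; exfalso.
have lk : (l < k)%N by rewrite kl.
pose P1 := \sum_(i < n | (i < l)%N) A k i l *: tnth w i.
pose P2 := \sum_(i < n | (i < k)%N) B k i l *: tnth w i.
pose Q := \sum_(j < n | (j < k)%N) conjc (B k l j) *: tnth w j.
have contract Z Y : (forall i : 'I_n, (i < l)%N -> ev (tnth w i) Z = 0) ->
    ev (tnth w k) (lie Z Y) = ev (tnth w l) Z * ev P1 Y
      + conjc (ev (tnth w l) Z) * ev P2 Y - ev (tnth w l) Z * conjc (ev Q Y).
  move=> Z0; apply: oppr_inj; rewrite (structure_equationE eqk).
  have le_l (i : 'I_n) : (i < k)%N -> i != l -> (i < l)%N.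
    by rewrite kl ltnS leq_eqVlt => /orP[/eqP/val_inj->|//]; rewrite eqxx.
  rewrite (big_single lk) => [|j jk jl]; last first.
    have jl' := le_l j jk jl; rewrite big1 // => i ij.
    by rewrite !Z0 ?(ltn_trans ij) // mul0r mulr0 subr0 mulr0.
  have -> : \sum_(i < n | (i < k)%N) \sum_(j < n | (j < k)%N) B k i j *
        (ev (tnth w i) Z * conjc (ev (tnth w j) Y)
         - ev (tnth w i) Y * conjc (ev (tnth w j) Z)) =
      ev (tnth w l) Z * conjc (ev Q Y) - conjc (ev (tnth w l) Z) * ev P2 Y.
    have -> : ev (tnth w l) Z * conjc (ev Q Y) =
        \sum_(i < n | (i < k)%N) \sum_(j < n | (j < k)%N)
          B k i j * (ev (tnth w i) Z * conjc (ev (tnth w j) Y)).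
      rewrite (big_single lk) => [|i ik il]; last first.
        by rewrite big1 // => j _; rewrite Z0 ?le_l // mul0r mulr0.
      rewrite -cdual_eval_conj conjv_sum cdual_eval_sum mulr_sumr.
      apply: eq_bigr => j _.
      by rewrite conjvZ cdual_evalZ conjcK cdual_eval_conj mulrCA.
    rewrite cdual_eval_sum mulr_sumr -sumrB; apply: eq_bigr => i _.
    have <- : \sum_(j < n | (j < k)%N) B k i j *
          (ev (tnth w i) Y * conjc (ev (tnth w j) Z)) =
        conjc (ev (tnth w l) Z) * ev (B k i l *: tnth w i) Y.
      rewrite (big_single lk) => [|j jk jl].
        by rewrite cdual_evalZ mulrA mulrC.
      by rewrite Z0 ?le_l // conjc0 !mulr0.
    by rewrite -sumrB; apply: eq_bigr => j _; rewrite mulrBr.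
  have -> : \sum_(i < n | (i < l)%N) A k i l *
        (ev (tnth w i) Z * ev (tnth w l) Y
         - ev (tnth w i) Y * ev (tnth w l) Z) =
      - (ev (tnth w l) Z * ev P1 Y).
    rewrite cdual_eval_sum mulr_sumr -sumrN; apply: eq_bigr => i il.
    by rewrite Z0 // cdual_evalZ; ring.
  move: (_ * ev P1 Y) (_ * ev P2 Y) (_ * conjc _) => u v t.
  by ring.
have JX0 (i : 'I_n) : (i < l)%N -> ev (tnth w i) (J X) = 0.
  by move=> il; rewrite wJ X0 ?mulr0.
have sumJ (F : 'I_n -> R[i]) (S : pred 'I_n) Y :
    ev (\sum_(i < n | S i) F i *: tnth w i) (J Y) =
    'i%C * ev (\sum_(i < n | S i) F i *: tnth w i) Y.
  rewrite !cdual_eval_sum mulr_sumr; apply: eq_bigr => i _.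
  by rewrite !cdual_evalZ wJ mulrCA.
have n2 : (2 : R[i]) != 0 by rewrite Num.Theory.pnatr_eq0.
have split Y : ev P1 Y = conjc (ev Q Y) /\ ev P2 Y = 0.
  have e1 := contract X Y X0; have e2 := contract (J X) Y JX0.
  rewrite dX -/x in e1; rewrite dJX wJ conjc_iM -/x in e2.
  exact: contraction_eq0 x0 e1 e2.
have Q0 : Q = 0.
  apply: cdual_inj => Y; rewrite cdual_eval0.
  have [e1 _] := split Y; have [e2 _] := split (J Y).
  have P1J : ev P1 (J Y) = 'i%C * ev P1 Y by exact: sumJ.
  have QJ : ev Q (J Y) = 'i%C * ev Q Y by exact: sumJ.
  rewrite P1J QJ conjc_iM e1 in e2.
  apply/eqP; rewrite -[ev Q Y]conjcK; move: (conjc _) e2 => q e2.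
  suff -> : q = 0 by rewrite conjc0.
  have /eqP : 2 * q = 0.
    transitivity (- 'i%C * ('i%C * q - (- 'i%C * q))); first by ring: (mulii R).
    by rewrite e2 subrr mulr0.
  by rewrite mulf_eq0 (negbTE n2) => /eqP.
have P10 : P1 = 0.
  apply: cdual_inj => Y; have [-> _] := split Y.
  by rewrite Q0 !cdual_eval0 conjc0.
have P20 : P2 = 0.
  by apply: cdual_inj => Y; have [_ ->] := split Y; rewrite cdual_eval0.
case: (nondeg k l kl) => -[i il /eqP[]].
- exact: (free_coef free_w P10 il).
- have := free_coef free_w Q0 (i := i); rewrite kl ltnS => /(_ il) c0.
  by rewrite -[LHS]conjcK c0 conjc0.
- by apply: (free_coef free_w P20); rewrite (ltn_trans il).
Qed.
End StructureEquations.

(** * Maximal nilpotent complex structures *)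

Section Characterization.
Variables (R : rcfType) (g : lieAlgType R) (J : 'End(g)).
Hypothesis cJ : complex_structure J.
Let n := dimC g.

Lemma maxN_structure : MaxN J ->
  exists (w : n.-tuple (cdual g)) (A B : 'I_n -> 'I_n -> 'I_n -> R[i]),
    [/\ basis_of (forms10 J) w, forall k, structure_equation w A B k
      & top_index_occurs A B].
Proof.
move=> maxN; pose w := [tuple flag_basis J i | i < n].
have wE i : tnth w i = flag_basis J i by rewrite tnth_mktuple.
have wd (k : 'I_n) :
    ce_d g (tnth w k) \in wedge_span (\sum_(i < n | (i < k)%N) <[tnth w i]>)%VS.
  rewrite (eq_bigr (fun i : 'I_n => <[flag_basis J i]>%VS)) => [|i _].
    by rewrite wE -flag_sum_ord // ce_d_flag ?flag_basis_mem.
  by rewrite wE.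
have [A /fin_all_exists[B AB]] : exists A : 'I_n -> 'I_n -> 'I_n -> R[i],
    forall k, exists b, structure_equation w A (fun=> b) k.
  pose eqn k a := exists b, structure_equation w (fun=> a) (fun=> b) k.
  apply: (fin_all_exists (P := eqn)) => k; rewrite /eqn /structure_equation.
  have := subvP (wedge_span_lines k (tnth w)) _ (wd k).
  case/memv_addP => b1 /memv_sum2_lines[a ->] [b2 /memv_sum2_lines[b ->] dE].
  by exists (fun i j => a j i), b.
have {}AB k : structure_equation w A B k by exact: AB.
exists w, A, B; split; [exact: basis_flag | exact: AB | move=> k l kl].
apply: contrapT => deg.
have kn : (l.+1 < n)%N by rewrite -kl.
have wk := flag_basis_mem J k; have nwk := flag_basis_notin cJ maxN (ltn_ord k).
rewrite kl in wk nwk; apply: (flag_d_nondegenerate cJ maxN kn wk nwk) => X Y Xl.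
suff : ev (tnth w k) (lie X Y) = 0 by rewrite wE kl.
apply: (top_index_absent_vanish _ (AB k) kl) => i il.
- by apply/eqP/contraT => c; case: deg; apply: Or31; exists i.
- by apply/eqP/contraT => c; case: deg; apply: Or32; exists i.
- by apply/eqP/contraT => c; case: deg; apply: Or33; exists i.
rewrite wE; apply: ann10_0 Xl.
exact: (subvP (flag_le J il)) (flag_basis_mem J i).
Qed.

(** Induction on [m]. If [asc J m] is the common kernel of the first [n - m]
    forms, then [X] is in [asc J m.+1] exactly when the differentials of these
    forms vanish on [X] and [J X]. This holds if the first [n - m.+1] forms kill [X],
    as they are the only ones to occur in these differentials; the converse is
    [top_index_vanish], applied to the forms in order. *)
Lemma structure_asc (w : n.-tuple (cdual g)) A B :
  basis_of (forms10 J) w -> (forall k, structure_equation w A B k) ->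
  top_index_occurs A B ->
  forall m X, (m <= n)%N ->
  X \in asc J m <-> (forall i : 'I_n, (i < n - m)%N -> ev (tnth w i) X = 0).
Proof.
move=> w_basis eqw nondeg.
have wJ i Y : ev (tnth w i) (J Y) = 'i%C * ev (tnth w i) Y.
  by apply: (iffRL (forms10P J _)); rewrite (basis_mem w_basis) ?mem_tnth.
elim=> [|m IHm] X mn.
  rewrite subn0; split=> [|X0].
    by rewrite memv0 => /eqP-> i _; rewrite /cdual_eval !linear0.
  apply: (ann10_separates cJ) => [|a]; first exact: (asc_J cJ (k := 0)).
  rewrite [ann10 J _]ann10_0v -(span_basis w_basis) => /coord_span->.
  rewrite cdual_eval_sum big1 // => i _.
  by rewrite cdual_evalZ -tnth_nth X0 ?mulr0.
have {}IHm := fun X => IHm X (ltnW mn).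
split=> [/ascSP Xm|X0].
  suff H j (i : 'I_n) : (i < j)%N -> (i < n - m.+1)%N -> ev (tnth w i) X = 0.
    by move=> i; apply: (H i.+1).
  elim: j i => // j IHj l; rewrite ltnS => lj lm.
  have km : (l.+1 < n - m)%N by rewrite -(subnSK mn) ltnS.
  have kn : (l.+1 < n)%N by rewrite (leq_trans km) ?leq_subr.
  apply: (top_index_vanish wJ (basis_free w_basis) nondeg
            (eqw (Ordinal kn))) => //.
  - by move=> i il; apply: IHj; [exact: leq_trans lj | exact: ltn_trans lm].
  - by move=> Y; have [/IHm XY _] := Xm Y; apply: XY.
  - by move=> Y; have [_ /IHm XY] := Xm Y; apply: XY.
have H Z Y : (forall i : 'I_n, (i < n - m.+1)%N -> ev (tnth w i) Z = 0) ->
    lie Z Y \in asc J m.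
  move=> Z0; apply/IHm => k km; apply: (structure_equation_vanish _ (eqw k)).
  by move=> i ik; apply: Z0; rewrite -ltnS subnSK // (leq_ltn_trans ik).
apply/ascSP => Y; split; apply: H => // i im.
by rewrite wJ X0 ?mulr0.
Qed.

Lemma structure_maxN (w : n.-tuple (cdual g)) A B :
  basis_of (forms10 J) w -> (forall k, structure_equation w A B k) ->
  top_index_occurs A B -> MaxN J.
Proof.
move=> w_basis eqw nondeg.
have ascE := structure_asc w_basis eqw nondeg.
have asc_n : asc J n = {:g}%VS.
  apply/eqP; rewrite eqEsubv subvf; apply/subvP => X _.
  by apply/ascE => // i; rewrite subnn.
have nJ : nilpotent_complex_structure J by exists n; rewrite asc_n.
split=> //; first exact: nilpotent_lie_of_asc asc_n.
apply/eqP; rewrite eqn_leq nu_min //= leqNgt; apply/negP => nu_lt.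
have n_gt0 : (0 < n)%N by apply: leq_ltn_trans nu_lt.
pose i0 := Ordinal n_gt0.
have : tnth w i0 != 0.
  by apply: free_not0 (basis_free w_basis) _; rewrite mem_tnth.
case/eqP; apply: cdual_inj => X; rewrite cdual_eval0.
by apply: (iffLR (ascE _ X (ltnW nu_lt))); rewrite ?nu_full ?memvf ?subn_gt0.
Qed.
End Characterization.

Theorem corollary1p6 (R : realType) (g : lieAlgType R) (J : 'End(g))
    (g_gt0 : (0 < \dim {:g})%N) (cJ : complex_structure J) :
  (MaxN J <->
   exists (w : (dimC g).-tuple (cdual g))
          (A B : 'I_(dimC g) -> 'I_(dimC g) -> 'I_(dimC g) -> R[i]),
     [/\ basis_of (forms10 J) w,
         forall k : 'I_(dimC g),
           ce_d g (tnth w k) =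
             \sum_(j < dimC g | (j < k)%N) \sum_(i < dimC g | (i < j)%N)
                A k i j *: wedge (tnth w i) (tnth w j) +
             \sum_(i < dimC g | (i < k)%N) \sum_(j < dimC g | (j < k)%N)
                B k i j *: wedge (tnth w i) (conjv (tnth w j))
       & forall k l : 'I_(dimC g), k = l.+1 :> nat ->
           [\/ exists2 i : 'I_(dimC g), (i < l)%N & A k i l != 0,
               exists2 j : 'I_(dimC g), (j <= l)%N & B k l j != 0
             | exists2 i : 'I_(dimC g), (i < l)%N & B k i l != 0]])
  /\
  (MaxN J -> forall k : nat, (k <= nu J)%N ->
     quot_cdual (asc J (nu J - k)) =
       (Wseries J k + conj_vspace (Wseries J k))%VS /\
     directv (Wseries J k + conj_vspace (Wseries J k))).
Proof.
split; last by move=> maxN k; exact: quot_cdual_asc_Wseries.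
split; first exact: maxN_structure.
case=> w [A [B [w_basis eqw nondeg]]].
exact: structure_maxN w_basis eqw nondeg.
Qed.
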